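(* Assume the local operator $A \colon \mathbb{V}_{\text{cell}} \to \mathbb{V}_{\text{cell}}^*$ is symmetric, and let $\tilde b \in \mathbb{V}_{\text{cell}}^*$. Let the initial guess $u_0 \in \mathbb{V}_{\text{cell}}$ satisfy $u_0 = \mathcal{G} u_0^{\text{global}}$ for some $u_0^{\text{global}} \in \mathbb{V}_{CG}$. Assume the preconditioner is consistent: at every iteration $k$ there exists a global preconditioner $P_{CG,k} \colon \mathbb{V}_{CG}^* \to \mathbb{V}_{CG}$ such that $$P_k = \mathcal{G}\, P_{CG,k}\, \mathcal{G}^T$$ (in particular, $P_k$ acts on a dual vector $\tilde r$ only through its assembly $\mathcal{G}^T \tilde r$, and its output is continuous, $\operatorname{Im}(P_k) \subseteq \operatorname{Im}(C)$). Then the sequence of primal iterates $\{u_k\} \subset \mathbb{V}_{\text{cell}}$ generated by the communication-free flexible conjugate gradient (FCG) algorithm with data $(u_0, \tilde b, A, \{P_k\})$ is identical to the sequence of iterates $\{u_k^{\text{global}}\} \subset \mathbb{V}_{CG}$ produced by standard FCG, started from $u_0^{\text{global}}$, applied to the explicitly assembled global system $A_{CG} u^{\text{global}} = b_{CG}$ with the preconditioners $P_{CG,k}$, where $A_{CG} = \mathcal{G}^T A \mathcal{G}$ and $b_{CG} = \mathcal{G}^T \tilde b$, in the sense that $$u_k = \mathcal{G}\, u_k^{\text{global}} \quad \text{for all } k \ge 0.$$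
   Context: Spaces. $\mathbb{V}_{CG}$ is the finite-dimensional real vector space of global (continuous finite element) coefficient vectors, with dual $\mathbb{V}_{CG}^*$. $\mathbb{V}_{\text{cell}}$ is the finite-dimensional real vector space of cell-wise (redundant, broken) coefficient vectors, in which every mesh element stores its own copy of its degrees of freedom, with dual $\mathbb{V}_{\text{cell}}^*$. In both cases $\langle \cdot,\cdot\rangle$ denotes the (Euclidean) duality pairing between a dual and a primal vector. Operators. $\mathcal{G} \colon \mathbb{V}_{CG} \to \mathbb{V}_{\text{cell}}$ is the linear gather operator, and $\mathcal{G}^T \colon \mathbb{V}_{\text{cell}}^* \to \mathbb{V}_{CG}^*$ is its adjoint, so that $\langle \tilde f, \mathcal{G} v\rangle = \langle \mathcal{G}^T \tilde f, v\rangle$ for all $\tilde f \in \mathbb{V}_{\text{cell}}^*$, $v \in \mathbb{V}_{CG}$. $C \colon \mathbb{V}_{\text{cell}} \to \mathbb{V}_{\text{cell}}$ is a linear idempotent map ($C^2 = C$) whose range is exactly $\mathcal{G}(\mathbb{V}_{CG})$; vectors in this range are called continuous. $A \colon \mathbb{V}_{\text{cell}} \to \mathbb{V}_{\text{cell}}^*$ is linear, and symmetric means $\langle A v, w\rangle = \langle A w, v\rangle$ for all $v,w \in \mathbb{V}_{\text{cell}}$. The preconditioners $P_k \colon \mathbb{V}_{\text{cell}}^* \to \mathbb{V}_{\text{cell}}$ may change from iteration to iteration. Communication-free FCG. Given $u_0 \in \mathbb{V}_{\text{cell}}$ and $\tilde b \in \mathbb{V}_{\text{cell}}^*$, set $\tilde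 r_0 = \tilde b - A u_0$, $z_0 = P_0(\tilde r_0)$, $p_0 = z_0$, and for $k = 0,1,2,\dots$: $$\tilde q_k = A p_k, \quad \alpha_k = \frac{\langle \tilde r_k, z_k\rangle}{\langle \tilde q_k, p_k\rangle}, \quad u_{k+1} = u_k + \alpha_k p_k, \quad \tilde r_{k+1} = \tilde r_k - \alpha_k \tilde q_k,$$ $$z_{k+1} = P_{k+1}(\tilde r_{k+1}), \quad \beta_k = \frac{-\langle \tilde q_k, z_{k+1}\rangle}{\langle \tilde q_k, p_k\rangle}, \quad p_{k+1} = z_{k+1} + \beta_k p_k .$$ Standard FCG for the assembled system $A_{CG} u^{\text{global}} = b_{CG}$ with preconditioners $P_{CG,k}$ is the same recurrence on $\mathbb{V}_{CG}$: $r_0^{\text{global}} = b_{CG} - A_{CG} u_0^{\text{global}}$, $z_0^{\text{global}} = P_{CG,0}(r_0^{\text{global}})$, $p_0^{\text{global}} = z_0^{\text{global}}$, and for $k = 0,1,2,\dots$: $$\alpha_k^{\text{global}} = \frac{\langle r_k^{\text{global}}, z_k^{\text{global}}\rangle}{\langle A_{CG} p_k^{\text{global}}, p_k^{\text{global}}\rangle}, \quad u_{k+1}^{\text{global}} = u_k^{\text{global}} + \alpha_k^{\text{global}} p_k^{\text{global}}, \quad r_{k+1}^{\text{global}} = r_k^{\text{global}} - \alpha_k^{\text{global}} A_{CG} p_k^{\text{global}},$$ $$z_{k+1}^{\text{global}} = P_{CG,k+1}(r_{k+1}^{\text{global}}), \quad \beta_k^{\text{global}} = \frac{-\langle A_{CG}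 p_k^{\text{global}}, z_{k+1}^{\text{global}}\rangle}{\langle A_{CG} p_k^{\text{global}}, p_k^{\text{global}}\rangle}, \quad p_{k+1}^{\text{global}} = z_{k+1}^{\text{global}} + \beta_k^{\text{global}} p_k^{\text{global}} .$$ Convention: as usual, iterates are considered as long as the denominators occurring in the recurrences are nonzero (the iteration stops otherwise), and ''for all $k\ge 0$'' refers to all iterates so produced. *)

(* Defs.v *)
From HB Require Import structures.
From mathcomp Require Import all_boot all_order all_algebra.
From mathcomp Require Import reals.

Set Implicit Arguments.
Unset Strict Implicit.
Unset Printing Implicit Defensive.

Import GRing.Theory.
Local Open Scope ring_scope.

(* For V = 'cV[R]_n, identifying a functional with its coefficient vector
   turns evaluation into the Euclidean pairing. *)
Definition dual (R : realType) (V : vectType R) := 'Hom(V, R^o).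

Definition pairing (R : realType) (V : vectType R) (f : dual V) (v : V) : R :=
  f v.

Section Adjoint.
Variables (R : realType) (U V : vectType R) (G : 'Hom(U, V)).

Definition adjoint_fun (f : dual V) : dual U :=
  (((f : 'Hom(V, R^o)) \o G)%VF : 'Hom(U, R^o)).

Fact adjoint_fun_is_linear : linear adjoint_fun.
Proof. by move=> a f g; rewrite /adjoint_fun comp_lfunDl comp_lfunZl. Qed.

HB.instance Definition _ :=
  GRing.isLinear.Build R (dual V) (dual U) _ adjoint_fun
    adjoint_fun_is_linear.

Definition adjoint : 'Hom(dual V, dual U) := linfun adjoint_fun.

Lemma adjointE (f : dual V) (v : U) : pairing (adjoint f) v = pairing f (G v).
Proof. by rewrite /adjoint lfunE /pairing comp_lfunE. Qed.

End Adjoint.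

Definition symmetric_op (R : realType) (V : vectType R)
    (A : 'Hom(V, dual V)) : Prop :=
  forall v w : V, pairing (A v) w = pairing (A w) v.

Section FCG.
Variables (R : realType) (V : vectType R).

(* The quantities (u_k, r_k, z_k, p_k) available at the start of iteration k. *)
Record fcg_state := FcgState
  { fcg_u : V; fcg_r : dual V; fcg_z : V; fcg_p : V }.

(* The preconditioners are arbitrary, possibly nonlinear, maps. *)
Variables (u0 : V) (b : dual V) (A : 'Hom(V, dual V)) (P : nat -> dual V -> V).

Definition fcg_init : fcg_state :=
  let r0 := b - A u0 in
  let z0 := P 0 r0 in
  FcgState u0 r0 z0 z0.

(* None: the denominator <A p_k, p_k>, which is shared by alpha_k and beta_k,
   vanishes and the iteration stops. *)
Definition fcg_step (k : nat) (s : fcg_state) : option fcg_state :=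
  let: FcgState u r z p := s in
  let q := A p in
  if pairing q p == 0 then None else
  let alpha := pairing r z / pairing q p in
  let u' := u + alpha *: p in
  let r' := r - alpha *: q in
  let z' := P k.+1 r' in
  let beta := - pairing q z' / pairing q p in
  Some (FcgState u' r' z' (z' + beta *: p)).

Fixpoint fcg (k : nat) : option fcg_state :=
  if k is k'.+1 then obind (fcg_step k') (fcg k') else Some fcg_init.

(* Some u_k if iterate k is produced, None if the iteration stopped before. *)
Definition fcg_iterate (k : nat) : option V := omap fcg_u (fcg k).

End FCG.

(* Main.v *)
Require Import Defs.
From mathcomp Require Import all_boot all_order all_algebra.
From mathcomp Require Import reals.

Import GRing.Theory.
Local Open Scope ring_scope.

(** Every scalar that FCG computes is a pairing of a dual vector with a search
    direction or a preconditioned residual, and those primal vectors are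
    continuous: they are gathered from global vectors.  By adjointness, pairing
    [f] with [G v] is pairing the assembled [adjoint G f] with [v], so the
    cell-wise run computes exactly the scalars of the global run, although the
    residual and [A p] that it pairs are unassembled.

    The induction therefore carries an asymmetric invariant, [assembles]: primal
    vectors of the cell-wise state are gathered from the global ones, whereas
    only the assembly of the cell-wise residual is the global residual.  It
    holds initially ([assembles_init]) and survives a step because all updates
    are linear with equal coefficients and the preconditioner sees only the
    assembled residual ([assembles_step]).  The denominators agree as well, so
    both runs stop at the same iteration. *)

(** The residual is related in the opposite direction to the primal vectors:
    [adjoint G] has a kernel in general, so the global residual does not
    determine the cell-wise one. *)
Definition assembles {R : realType} {U V : vectType R} (G : 'Hom(U, V))
    (s : fcg_state V) (t : fcg_state U) : Prop :=
  [/\ fcg_u s = G (fcg_u t), adjoint G (fcg_r s) = fcg_r t,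
      fcg_z s = G (fcg_z t) & fcg_p s = G (fcg_p t)].

Definition assembles_opt {R : realType} {U V : vectType R} (G : 'Hom(U, V))
    (s : option (fcg_state V)) (t : option (fcg_state U)) : Prop :=
  match s, t with
  | Some s, Some t => assembles G s t
  | None, None => True
  | _, _ => False
  end.

Lemma assembled_opE {R : realType} {U V : vectType R} (G : 'Hom(U, V))
    (A : 'Hom(V, dual V)) (v : U) :
  (adjoint G \o A \o G)%VF v = adjoint G (A (G v)).
Proof. by rewrite !comp_lfunE. Qed.

Section Simulation.
Variables (R : realType) (U V : vectType R) (G : 'Hom(U, V)).
Variables (A : 'Hom(V, dual V)) (b : dual V) (v0 : U).
Variables (P : nat -> dual V -> V) (PCG : nat -> dual U -> U).
Hypothesis P_consistent :
  forall (k : nat) (r : dual V), P k r = G (PCG k (adjoint G r)).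

Let ACG : 'Hom(U, dual U) := (adjoint G \o A \o G)%VF.

Lemma assembles_init :
  assembles G (fcg_init (G v0) b A P) (fcg_init v0 (adjoint G b) ACG PCG).
Proof. by split; rewrite /= ?P_consistent ?linearB /= ?assembled_opE. Qed.

Lemma assembles_step (k : nat) (s : fcg_state V) (t : fcg_state U) :
  assembles G s t ->
  assembles_opt G (fcg_step A P k s) (fcg_step ACG PCG k t).
Proof.
case: s t => [u r z p] [u' r' z' p'] [/= -> <- -> ->].
(* [P_consistent] comes before [adjointE]: it exhibits the new [z] as gathered,
   so that the numerator of beta can also be read as a global pairing. *)
rewrite /fcg_step /ACG assembled_opE !P_consistent -!adjointE.
case: ifP => // _.
by split; rewrite /= ?linearD ?linearN ?linearZ.
Qed.

Lemma assembles_fcg (k : nat) :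
  assembles_opt G (fcg (G v0) b A P k) (fcg v0 (adjoint G b) ACG PCG k).
Proof.
elim: k => [|k] /=; first exact: assembles_init.
by case: fcg => [s|]; case: fcg => [t|] //=; apply: assembles_step.
Qed.

End Simulation.

Theorem theorem1 (R : realType) (VCG Vcell : vectType R)
    (G : 'Hom(VCG, Vcell))
    (C : 'End(Vcell))
    (C_idem : (C \o C)%VF = C)
    (C_range : limg C = limg G)
    (A : 'Hom(Vcell, dual Vcell))
    (A_sym : symmetric_op A)
    (b : dual Vcell)
    (u0 : Vcell) (u0_glob : VCG)
    (u0_cont : u0 = G u0_glob)
    (P : nat -> dual Vcell -> Vcell)
    (PCG : nat -> dual VCG -> VCG)
    (P_consistent : forall (k : nat) (r : dual Vcell),
        P k r = G (PCG k (adjoint G r))) :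
  let ACG : 'Hom(VCG, dual VCG) := (adjoint G \o A \o G)%VF in
  let bCG : dual VCG := adjoint G b in
  forall k : nat,
    fcg_iterate u0 b A P k
    = omap (fun v : VCG => G v) (fcg_iterate u0_glob bCG ACG PCG k).
Proof.
move=> ACG bCG k; rewrite u0_cont /fcg_iterate.
have := @assembles_fcg _ _ _ _ A b u0_glob _ _ P_consistent k.
rewrite -/ACG -/bCG.
by case: fcg => [s|]; case: fcg => [t|] //= [-> _ _ _].
Qed.
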